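(* The density of a particular letter in the Fibonacci word is given by the following formula: $$\lim_{n\to\infty} D(n)=\lim_{n\to\infty}\frac{F(n)}{F(n+1)}=\varphi-1,$$ where $\varphi$ is the golden ratio, $D(n)$ is the density of the letter in the first $n$ terms of the Fibonacci word, and $F(n)$ is the $n$-th Fibonacci number.
   Context: The Fibonacci word is the infinite binary word $0100101001001\ldots$ that is the limit of the finite words $f_1=1$, $f_2=0$, $f_n=f_{n-1}f_{n-2}$ (concatenation); equivalently, it is generated by the morphism $0\mapsto 01$, $1\mapsto 0$. The density of a letter in the first $n$ terms is the number of occurrences of the letter among those $n$ terms divided by $n$. The density of the letter in the infinite word is the limit of the ratio of the number of occurrences of the letter to the length of the word, as the length goes to infinity. The golden ratio is $\varphi=\frac{1+\sqrt5}{2}$, and the Fibonacci numbers are $F(n)=\frac{\varphi^n-(1-\varphi)^n}{\sqrt5}$, satisfying $F(n)=F(n-1)+F(n-2)$. *)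

(* Defs.v *)
From HB Require Import structures.
From mathcomp Require Import all_boot all_order all_algebra.
From mathcomp Require Import all_classical all_reals all_analysis.
From mathcomp Require Import zify ring lra.
Set Implicit Arguments.
Unset Strict Implicit.
Unset Printing Implicit Defensive.
Import Order.TTheory GRing.Theory Num.Theory.
Import numFieldNormedType.Exports.
Local Open Scope ring_scope.

(** Binary words are words over [bool]: the letter 0 is [false] and the
    letter 1 is [true]. *)

(** The index starts at 1; the value at 0 is a dummy that the recursion never
    reaches. *)
Fixpoint fibw (n : nat) : seq bool :=
  match n with
  | 0 => [::]
  | m.+1 => match m with
            | 0 => [:: true]
            | k.+1 => if k is 0 then [:: false] else fibw m ++ fibw k
            end
  end.

Definition is_word_limit (f : nat -> seq bool) (u : nat -> bool) : Prop :=
  forall i : nat, exists N : nat, forall n : nat, (N <= n)%N ->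
    (i < size (f n))%N /\ nth false (f n) i = u i.

(** From [n = 2] on, [fibw n] is a prefix of [fibw n.+1] and has more than
    [n - 2] letters, so [fibw i.+2] already determines the letter of index [i]
    of the limit; see [fibword_limit]. *)
Definition fibword (i : nat) : bool := nth false (fibw i.+2) i.

Lemma fibwSSS n : fibw n.+3 = fibw n.+2 ++ fibw n.+1.
Proof. by []. Qed.

Lemma size_fibw_gt n : (n < size (fibw n.+2))%N.
Proof.
suff: (n < size (fibw n.+2))%N && (0 < size (fibw n.+1))%N by case/andP.
elim: n => [//|n /andP[IH1 IH2]].
by rewrite fibwSSS size_cat; apply/andP; split; lia.
Qed.

Lemma nth_fibw i n : (i.+2 <= n)%N -> nth false (fibw n) i = fibword i.
Proof.
move=> /subnKC <-; elim: (n - i.+2)%N => [|k IH]; first by rewrite addn0.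
rewrite addnS !addSn fibwSSS nth_cat -!addSn IH.
by have := size_fibw_gt (i + k); rewrite -!addSn => ?; rewrite ifT //; lia.
Qed.

Lemma fibword_limit : is_word_limit fibw fibword.
Proof.
move=> i; exists i.+2 => n le_n; split; last exact: nth_fibw.
case: n le_n => [|[|n]] // le_n.
by apply: leq_trans (size_fibw_gt n); lia.
Qed.

Lemma is_word_limit_unique f u v :
  is_word_limit f u -> is_word_limit f v -> u =1 v.
Proof.
move=> fu fv i; have [N HN] := fu i; have [M HM] := fv i.
have [_ <-] := HN (maxn N M) (leq_maxl _ _).
by have [_ <-] := HM (maxn N M) (leq_maxr _ _).
Qed.

Example fibword_prefix :
  [seq nat_of_bool b | b <- mkseq fibword 13] =
    [:: 0; 1; 0; 0; 1; 0; 1; 0; 0; 1; 0; 0; 1]%N.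
Proof. by []. Qed.

(** The value at [n = 0] is [0 / 0 = 0]. *)
Definition prefix_density (R : realType) (u : nat -> bool) (a : bool)
    (n : nat) : R :=
  (count_mem a (mkseq u n))%:R / n%:R.

Definition golden (R : realType) : R := (1 + Num.sqrt 5) / 2.

Definition Fib (R : realType) (n : nat) : R :=
  (golden R ^+ n - (1 - golden R) ^+ n) / Num.sqrt 5.

Lemma golden_sqr (R : realType) : golden R ^+ 2 = golden R + 1.
Proof.
have s5 : Num.sqrt 5 ^+ 2 = 5 :> R by rewrite sqr_sqrtr.
by rewrite /golden; move: s5; set s := Num.sqrt 5 => s5; field: s5.
Qed.

Lemma Fib0 (R : realType) : Fib R 0 = 0.
Proof. by rewrite /Fib !expr0 subrr mul0r. Qed.

Lemma Fib1 (R : realType) : Fib R 1 = 1.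
Proof.
have s5 : Num.sqrt 5 != 0 :> R by rewrite gt_eqF // sqrtr_gt0.
by rewrite /Fib !expr1 /golden; field.
Qed.

Lemma FibSS (R : realType) (n : nat) : Fib R n.+2 = Fib R n.+1 + Fib R n.
Proof.
rewrite /Fib -mulrDl; congr (_ / _).
have g2 := golden_sqr R; move: g2; set g := golden R => g2.
have h2 : (1 - g) ^+ 2 = (1 - g) + 1 by ring: g2.
have E (x : R) : x ^+ 2 = x + 1 -> x ^+ n.+2 = x ^+ n.+1 + x ^+ n.
  by move=> x2; rewrite -addn2 exprD x2 exprS; ring.
by rewrite !E //; ring.
Qed.

(* Main.v *)
Require Import Defs.
From mathcomp Require Import all_boot all_order all_algebra.
From mathcomp Require Import all_classical all_reals all_analysis.
From mathcomp Require Import lra ring.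
Import Order.TTheory GRing.Theory Num.Theory.
Import numFieldNormedType.Exports.
Local Open Scope classical_set_scope.
Local Open Scope ring_scope.

(** Put [t = golden R - 1]. Then [t ^+ 2 = 1 - t], so [- t = 1 - golden R] is
    the conjugate root of [x ^+ 2 = x + 1]. Measure a word [w] by its
    discrepancy, the number of its zeros minus [t] times its length. It is
    additive under concatenation, so along the Fibonacci words it satisfies the
    Fibonacci recurrence; its first two values are [- t] and [(- t) ^+ 2], hence
    the [n]-th Fibonacci word has discrepancy exactly [(- t) ^+ n]
    ([discrepancy_fibw]).

    A prefix of the infinite word is a concatenation of Fibonacci words of
    strictly decreasing index (the greedy, or Zeckendorf, decomposition), so its
    discrepancy is bounded by a geometric series of ratio [t < 1]
    ([discrepancy_take_fibw]). Likewise [Fib R n - t * Fib R n.+1] is a power of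
    [- t] ([Fib_sub_golden]). In both cases the numerator stays within a bounded
    distance of [t] times the denominator while the denominator grows at least
    linearly, so the quotient tends to [t] ([cvg_ratio_bounded_dist]). *)

Lemma cvg_ratio_bounded_dist (R : realType) (t K : R) (x y : nat -> R) :
  (forall n, n%:R <= y n) -> (forall n, `|x n - t * y n| <= K) ->
  (fun n => x n / y n) @ \oo --> t.
Proof.
move=> le_y le_K; apply/cvgrPdist_le => e e0; near=> n.
have n0 : 0 < n%:R :> R by rewrite ltr0n; near: n; exact: nbhs_infty_gt.
have y0 : 0 < y n := lt_le_trans n0 (le_y n).
have -> : t - x n / y n = - ((x n - t * y n) / y n).
  by field; rewrite gt_eqF.
rewrite normrN normrM normfV (gtr0_norm y0) ler_pdivrMr //.
apply: le_trans (le_K n) _; apply: le_trans (_ : e * n%:R <= _); last first.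
  by rewrite ler_pM2l.
by rewrite mulrC -ler_pdivrMr //; near: n; exact: nbhs_infty_ger.
Unshelve. all: by end_near. Qed.

Lemma golden_gt1 (R : realType) : 1 < golden R.
Proof.
have : 1 < Num.sqrt 5 :> R by rewrite -[ltLHS]sqrtr1 ltr_sqrt // ltr1n.
by rewrite /golden; lra.
Qed.

Lemma golden_lt2 (R : realType) : golden R < 2.
Proof. by have := golden_sqr R; have := golden_gt1 R; nra. Qed.

Lemma golden_sub1_sqr (R : realType) :
  (golden R - 1) ^+ 2 = 1 - (golden R - 1).
Proof. by have g2 := golden_sqr R; ring: g2. Qed.

Definition discrepancy (R : realType) (w : seq bool) : R :=
  (count_mem false w)%:R - (golden R - 1) * (size w)%:R.

Lemma discrepancy_cat (R : realType) v w :
  discrepancy R (v ++ w) = discrepancy R v + discrepancy R w.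
Proof. by rewrite /discrepancy count_cat size_cat !natrD; ring. Qed.

Lemma discrepancy_fibw (R : realType) n :
  discrepancy R (fibw n.+1) = (- (golden R - 1)) ^+ n.+1.
Proof.
have t2 := golden_sub1_sqr R.
suff [] : discrepancy R (fibw n.+1) = (- (golden R - 1)) ^+ n.+1 /\
    discrepancy R (fibw n.+2) = (- (golden R - 1)) ^+ n.+2 by [].
elim: n => [|n [IH1 IH2]].
  rewrite /discrepancy /=; move: t2; set t := golden R - 1 => t2.
  by split; [ring | ring: t2].
split=> //; rewrite fibwSSS discrepancy_cat IH1 IH2.
move: t2; set t := golden R - 1 => t2.
by rewrite (exprS _ n.+2) (exprS _ n.+1); ring: t2.
Qed.

(** A prefix of [fibw n.+3] is a prefix of [fibw n.+2], or all of [fibw n.+2]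
    followed by a prefix of [fibw n.+1]. Each power of [t = golden R - 1] is
    therefore added at most once. The right-hand side is [t ^+ 2] times a partial
    sum of the geometric series of ratio [t], since [1 - t = t ^+ 2]. *)
Lemma discrepancy_take_fibw (R : realType) n k :
  (golden R - 1) ^+ 2 * `|discrepancy R (take k (fibw n.+1))|
    <= 1 - (golden R - 1) ^+ n.+2.
Proof.
have := golden_sub1_sqr R; have := golden_gt1 R; have := golden_lt2 R.
move: (discrepancy_fibw R).
have d0 : discrepancy R [::] = 0 by rewrite /discrepancy /= mulr0 subrr.
set t := golden R - 1 => disc lt2 gt1 t2.
have t0 : 0 < t by rewrite subr_gt0.
have t1 : t < 1 by rewrite /t; lra.
pose bounded m :=
  forall k, t ^+ 2 * `|discrepancy R (take k (fibw m))| <= 1 - t ^+ m.+1.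
suff H : bounded n.+1 /\ bounded n.+2 by exact: H.1.
have pow_le1 m : t ^+ m <= 1 by rewrite exprn_ile1 // ltW.
have dfibw m : `|discrepancy R (fibw m.+1)| = t ^+ m.+1.
  by rewrite disc normrX normrN gtr0_norm.
elim: n {k} => [|n [IH1 IH2]].
  split=> -[|k]; rewrite ?take0 ?d0 ?normr0 ?mulr0 ?subr_ge0 //.
    rewrite take_oversize // dfibw; nra.
  rewrite take_oversize // dfibw; nra.
have le_pow : 1 - t ^+ n.+3 <= 1 - t ^+ n.+4.
  by rewrite lerD2l lerN2 [leLHS]exprS ler_piMl ?exprn_ge0 // ltW.
split=> // k; apply: le_trans le_pow; rewrite fibwSSS take_cat.
case: ltnP => _; first exact: IH2.
rewrite discrepancy_cat.
apply: le_trans (ler_wpM2l _ (ler_normD _ _)) _; first exact: sqr_ge0.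
rewrite dfibw mulrDr; apply: le_trans (lerD (lexx _) (IH1 _)) _.
(* [1 - t ^+ 2 = t] turns the two powers on the right into one *)
suff -> : 1 - t ^+ n.+3 = t ^+ 2 * t ^+ n.+2 + (1 - t ^+ n.+2) by [].
by rewrite (exprS t n.+2); ring: t2.
Qed.

Lemma mkseq_fibword n : mkseq fibword n = take n (fibw n.+2).
Proof.
have le_n := ltnW (size_fibw_gt n).
apply: (@eq_from_nth _ false); first by rewrite size_mkseq size_takel.
rewrite size_mkseq => i lt_in.
by rewrite nth_mkseq // nth_take // nth_fibw // !ltnS ltnW.
Qed.

Lemma Fib_sub_golden (R : realType) n :
  Fib R n - (golden R - 1) * Fib R n.+1 = (- (golden R - 1)) ^+ n.+1.
Proof.
have t2 := golden_sub1_sqr R.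
suff [] : Fib R n - (golden R - 1) * Fib R n.+1 = (- (golden R - 1)) ^+ n.+1 /\
  Fib R n.+1 - (golden R - 1) * Fib R n.+2 = (- (golden R - 1)) ^+ n.+2 by [].
elim: n => [|n [IH1 IH2]].
  rewrite FibSS Fib0 Fib1; move: t2; set t := golden R - 1 => t2.
  by split; [ring | ring: t2].
split=> //; rewrite (FibSS R n.+1) {1}(FibSS R n) mulrDr opprD addrACA IH1 IH2.
move: t2; set t := golden R - 1 => t2.
by rewrite (exprS _ n.+2) (exprS _ n.+1); ring: t2.
Qed.

Lemma Fib_ge_pred (R : realType) n : n%:R <= Fib R n.+1.
Proof.
(* two consecutive cases, and the lower bound [1] on the summand added in the
   Fibonacci recurrence *)
suff [] : n%:R <= Fib R n.+1 /\ n.+1%:R <= Fib R n.+2 /\ 1 <= Fib R n.+1 by [].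
elim: n => [|n [IH1 [IH2 IH3]]].
  by rewrite FibSS Fib0 Fib1 addr0.
have n0 : 0 <= n%:R :> R := ler0n _ _.
by rewrite (FibSS R n.+1); move: IH2; rewrite -!natr1; lra.
Qed.

Theorem theorem3p7 (R : realType) :
  (fun n : nat => prefix_density R fibword false n) @ \oo --> golden R - 1 /\
  (fun n : nat => Fib R n / Fib R n.+1) @ \oo --> golden R - 1.
Proof.
have t0 : 0 < golden R - 1 by rewrite subr_gt0 golden_gt1.
have t1 : golden R - 1 < 1 by have := golden_lt2 R; lra.
split.
  apply: (@cvg_ratio_bounded_dist _ _ ((golden R - 1) ^- 2) _ (fun n => n%:R)) => // n.
  have := discrepancy_take_fibw R n.+1 n.
  rewrite -mkseq_fibword /discrepancy size_mkseq => le1.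
  rewrite -[leRHS]mul1r ler_pdivlMr ?exprn_gt0 // mulrC.
  by apply: le_trans le1 _; rewrite gerBl exprn_ge0 // ltW.
apply: (@cvg_ratio_bounded_dist _ _ 1) => n; first exact: Fib_ge_pred.
by rewrite Fib_sub_golden normrX normrN gtr0_norm // exprn_ile1 // ltW.
Qed.
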